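(* Let $\Box=[0,1]\times[0,1]$ be the unit square and $p_1,p_2:\Box\times\Box\to\Box$ the product projections. For $F\in\mathrm{Sh}(\mathsf{CHaus})$, the following are equivalent: (1) The canonical map $(F(p_1),F(p_2)):F(\Box\times\Box)\to F(\Box)\times F(\Box)$ is bijective. (2) $F$ satisfies the sheaf condition on every effective-monic cone $\{f_i:X\to Y_i\}$ in $\mathsf{CHaus}$. (3) $F$ is representable, i.e. isomorphic to $\mathsf{CHaus}(W,-)$ for some $W\in\mathsf{CHaus}$.
   Context: $\mathsf{CHaus}$ is the category of compact Hausdorff spaces and continuous maps. A cone in $\mathsf{CHaus}$ is a small family of morphisms $\{f_i:X\to Y_i\}_{i\in I}$ with common domain. For a functor $F:\mathsf{CHaus}\to\mathsf{Set}$, a family $(\beta_i)_{i\in I}$ with $\beta_i\in F(Y_i)$ is compatible if for all $i,j\in I$ and all morphisms $g:Y_i\to Z$, $h:Y_j\to Z$ with $gf_i=hf_j$ one has $F(g)(\beta_i)=F(h)(\beta_j)$. $F$ satisfies the sheaf condition on $\{f_i\}$ if $\alpha\mapsto (F(f_i)(\alpha))_{i\in I}$ is a bijection from $F(X)$ to the set of compatible families. A cone is effective-monic if every representable functor $\mathsf{CHaus}(W,-)$ satisfies the sheaf condition on it. A cone $\{g_j:Y\to Z_j\}_j$ separates points if the $g_j$ are jointly injective. An effective-monic cone $\{f_i:X\to Y_i\}_{i\in I}$ is directed if for every $i\in I$ there is a cone $\{g_i^j:Y_i\to Z_i^j\}_{j\in J_i}$ which separates points, such that for all $i,i'\in I$,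 $j\in J_i$, $j'\in J_{i'}$ there are $k\in I$ and morphisms $p:Y_k\to Z_i^j$, $q:Y_k\to Z_{i'}^{j'}$ with $pf_k=g_i^jf_i$ and $qf_k=g_{i'}^{j'}f_{i'}$. A functor $F:\mathsf{CHaus}\to\mathsf{Set}$ is a sheaf if it satisfies the sheaf condition on every directed effective-monic cone; $\mathrm{Sh}(\mathsf{CHaus})$ is the full subcategory of the functor category $\mathsf{Set}^{\mathsf{CHaus}}$ on the sheaves. *)

(* Defs.v *)
From HB Require Import structures.
From mathcomp Require Import all_boot all_order all_algebra.
From mathcomp Require Import all_classical all_reals all_analysis.

Set Implicit Arguments.
Unset Strict Implicit.
Unset Printing Implicit Defensive.

Import Order.TTheory GRing.Theory Num.Theory.
Import numFieldNormedType.Exports.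

Local Open Scope classical_set_scope.

(* One fixed universe plays the role of the small sets: it bounds the index
   sets of cones and the values of set-valued functors. [small_space] (together
   with [hom_functor] below) identifies it with the universe of the carriers of
   topological spaces, so that every small set can carry a topology. *)
Definition SmallSet := Type.

Definition small_space (T : SmallSet) (topT : Topological T) : topologicalType :=
  Topological.Pack topT.

Record CHaus := MkCHaus {
  chaus_space :> topologicalType;
  chaus_space_compact : compact [set: chaus_space];
  chaus_space_hausdorff : hausdorff_space chaus_space
}.

Definition chaus_hom (X Y : CHaus) := continuousType X Y.

Definition chaus_id (X : CHaus) : chaus_hom X X := idfun.

Definition chaus_comp (X Y Z : CHaus) (g : chaus_hom Y Z)
    (f : chaus_hom X Y) : chaus_hom X Z :=
  g \o f.

Record set_functor := SetFunctor {
  fobj :> CHaus -> SmallSet;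
  fmor : forall X Y : CHaus, chaus_hom X Y -> fobj X -> fobj Y;
  fmor_id : forall (X : CHaus) (a : fobj X), fmor (chaus_id X) a = a;
  fmor_comp : forall (X Y Z : CHaus) (g : chaus_hom Y Z) (f : chaus_hom X Y)
      (a : fobj X),
    fmor (chaus_comp g f) a = fmor g (fmor f a)
}.

Arguments fmor F {X Y} f a : rename.

Record nat_trans (F G : set_functor) := NatTrans {
  nat_component :> forall X : CHaus, F X -> G X;
  naturality : forall (X Y : CHaus) (f : chaus_hom X Y) (a : F X),
    nat_component (fmor F f a) = fmor G f (nat_component a)
}.

Arguments nat_component {F G} s X a : rename.

Definition functor_iso (F G : set_functor) : Prop :=
  exists (s : nat_trans F G) (t : nat_trans G F),
    (forall X : CHaus, cancel (s X) (t X)) /\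
    (forall X : CHaus, cancel (t X) (s X)).

Section HomFunctor.
Variable W : CHaus.

Definition hom_map (X Y : CHaus) (f : chaus_hom X Y)
    (a : chaus_hom W X) : chaus_hom W Y :=
  chaus_comp f a.

Lemma hom_map_id (X : CHaus) (a : chaus_hom W X) : hom_map (chaus_id X) a = a.
Proof. exact/continuousEP. Qed.

Lemma hom_map_comp (X Y Z : CHaus) (g : chaus_hom Y Z) (f : chaus_hom X Y)
  (a : chaus_hom W X) : hom_map (chaus_comp g f) a = hom_map g (hom_map f a).
Proof. exact/continuousEP. Qed.

Definition hom_functor : set_functor :=
  @SetFunctor (fun X => chaus_hom W X) hom_map hom_map_id hom_map_comp.

End HomFunctor.

Definition representable (F : set_functor) : Prop :=
  exists W : CHaus, functor_iso F (hom_functor W).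

Record cone (X : CHaus) := Cone {
  cone_index : SmallSet;
  cone_cod : cone_index -> CHaus;
  cone_map : forall i : cone_index, chaus_hom X (cone_cod i)
}.

Arguments cone_cod {X} c i : rename.
Arguments cone_map {X} c i : rename.

Definition compatible_families (F : set_functor) (X : CHaus) (c : cone X) :
    set (forall i : cone_index c, F (cone_cod c i)) :=
  [set b | forall (i j : cone_index c) (Z : CHaus)
             (g : chaus_hom (cone_cod c i) Z) (h : chaus_hom (cone_cod c j) Z),
             chaus_comp g (cone_map c i) = chaus_comp h (cone_map c j) ->
             fmor F g (b i) = fmor F h (b j)].

Definition sheaf_condition (F : set_functor) (X : CHaus) (c : cone X) : Prop :=
  set_bij [set: F X] (@compatible_families F X c)
    (fun a i => fmor F (cone_map c i) a).

Definition effective_monic (X : CHaus) (c : cone X) : Prop :=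
  forall W : CHaus, sheaf_condition (hom_functor W) c.

Definition separates_points (Y : CHaus) (d : cone Y) : Prop :=
  forall y y' : Y,
    (forall j : cone_index d, cone_map d j y = cone_map d j y') -> y = y'.

Definition directed_effective_monic (X : CHaus) (c : cone X) : Prop :=
  effective_monic c /\
  exists d : forall i : cone_index c, cone (cone_cod c i),
    (forall i : cone_index c, separates_points (d i)) /\
    (forall (i i' : cone_index c)
            (j : cone_index (d i)) (j' : cone_index (d i')),
      exists (k : cone_index c) (p : chaus_hom (cone_cod c k) (cone_cod (d i) j))
             (q : chaus_hom (cone_cod c k) (cone_cod (d i') j')),
        chaus_comp p (cone_map c k) =
          chaus_comp (cone_map (d i) j) (cone_map c i) /\
        chaus_comp q (cone_map c k) =
          chaus_comp (cone_map (d i') j') (cone_map c i')).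

Definition is_sheaf (F : set_functor) : Prop :=
  forall (X : CHaus) (c : cone X),
    directed_effective_monic c -> sheaf_condition F c.

Section Product.
Variables X Y : CHaus.

Lemma chaus_prod_compact : compact [set: X * Y].
Proof.
by rewrite -setXTT; apply: compact_setX; exact: chaus_space_compact.
Qed.

Lemma chaus_prod_hausdorff : hausdorff_space (X * Y)%type.
Proof.
move=> [x y] [x' y'] cl; congr (_, _).
- apply: (@chaus_space_hausdorff X) => A B Ax Bx.
  have [] := cl (fst @^-1` A) (fst @^-1` B) (cvg_fst Ax) (cvg_fst Bx).
  by move=> z [? ?]; exists z.1.
- apply: (@chaus_space_hausdorff Y) => A B Ax Bx.
  have [] := cl (snd @^-1` A) (snd @^-1` B) (cvg_snd Ax) (cvg_snd Bx).
  by move=> z [? ?]; exists z.2.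
Qed.

Definition chaus_prod : CHaus :=
  MkCHaus chaus_prod_compact chaus_prod_hausdorff.

Lemma fst_cts : continuous (@fst X Y : chaus_prod -> X).
Proof. by move=> z; exact: cvg_fst. Qed.

Lemma snd_cts : continuous (@snd X Y : chaus_prod -> Y).
Proof. by move=> z; exact: cvg_snd. Qed.

Definition chaus_fst : chaus_hom chaus_prod X := mkcts fst_cts.
Definition chaus_snd : chaus_hom chaus_prod Y := mkcts snd_cts.

End Product.

Arguments chaus_fst {X Y}.
Arguments chaus_snd {X Y}.

Section UnitInterval.
Variable R : realType.
Local Open Scope ring_scope.

Let I01 : set R := `[0, 1].

Lemma itv01_compact : compact [set: set_type I01].
Proof.
have I0 : 0 \in I01 by rewrite inE /I01 /= in_itv /= lexx ler01.
pose z : set_type I01 := exist _ 0 I0.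
have : {within I01, continuous (valL_ z (@id (set_type I01)))}.
  by apply/subspace_valL_continuousP' => x.
move=> /continuous_compact /(_ (@segment_compact R 0 1)).
congr compact; apply/seteqP; split=> // x _.
exists (set_val x); first exact: set_valP.
exact: (congr1 (fun f => f x) (valLK z id)).
Qed.

Lemma itv01_hausdorff : hausdorff_space (set_type I01).
Proof.
move=> x y cl; apply: val_inj; apply: (@Rhausdorff R) => A B Ax By.
have [] := cl (set_val @^-1` A) (set_val @^-1` B).
- exact: (@initial_continuous _ _ set_val).
- exact: (@initial_continuous _ _ set_val).
by move=> t [? ?]; exists (set_val t).
Qed.

Definition unit_interval : CHaus := MkCHaus itv01_compact itv01_hausdorff.
Definition unit_square : CHaus := chaus_prod unit_interval unit_interval.

End UnitInterval.

(* Main.v *)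
Require Import Defs.
From mathcomp Require Import all_boot all_order all_algebra.
From mathcomp Require Import all_classical all_reals all_analysis.
From mathcomp Require Import lra.

(** Write [I] for the unit interval and [S] for the unit square.  A
    representable functor satisfies the sheaf condition on all effective-monic
    cones by the very definition of these, and the two projections of [S * S]
    form such a cone.  What remains is that a sheaf [F] with
    [F (S * S) = F S * F S] is representable.  This is Gelfand duality, with
    [I] in the place of the complex numbers.

    Since [I] is a retract of [S], also [F S = F I * F I]; so every continuous
    map [S -> I] acts as a binary operation on [F I].  A character is a map
    [F I -> I] that commutes with all these operations.  The characters form a
    closed subspace [W] of the power of [I] with exponent [F I], and [W]
    represents [F].  Two facts about characters carry the proof.

    - Characters separate the elements of [F I] ([characters_separate]).  If
      [a] and [b] differ, some operation that is zero on the diagonal of [S] has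
      a nonzero value [d] at [(a, b)].  By the sheaf condition for the
      truncations [x |-> max (x - e) 0], some [max (d - e) 0] with [e > 0] is
      nonzero; this takes the part that the norm has for C*-algebras.  A
      maximal filter of nonzero elements that contains [max (d - e) 0] then
      assigns a value in [I] to each element of [F I], by compactness, and this
      is a character that does not vanish at [d].
    - A map [C(X, I) -> I] that commutes with the binary operations is the
      evaluation at a point of [X] ([homomorphism_is_evaluation]).  The reason
      is the compactness argument that also produced the values above
      ([ideal_common_zero]): a set of functions that contains 0 and is closed
      under [max] and scaling has a common zero unless it contains the
      constant 1.

    Two further cones then suffice.  All pairs of evaluations at elements of
    [F I] form a directed effective-monic cone [W -> S] indexed by [F S], and
    the first fact says that the elements of [F S] are a compatible family on
    it; so there is [u] in [F W] whose image under the evaluation at [a] is [a]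
    ([universal_element]).  The map [m |-> F m u] from [C(W, X)] to [F X] is
    injective by the second fact, and surjective because the cone of all maps
    [X -> S] is directed and effective-monic, so that an element of [F X] is
    determined by its images in [F S].  Both cones are directed because any
    coordinates of two of their maps to [S] can be paired into a third. *)

Set Implicit Arguments.
Unset Strict Implicit.
Unset Printing Implicit Defensive.

Import Order.TTheory GRing.Theory Num.Theory.
Import numFieldNormedType.Exports.

(** * Compact Hausdorff spaces and effective-monic cones *)

Section Spaces.
Local Open Scope classical_set_scope.

Lemma chaus_hom_ext (X Y : CHaus) (f g : chaus_hom X Y) : f =1 g -> f = g.
Proof. by move/continuousEP. Qed.

Definition chaus_pair (V X Y : CHaus) (f : chaus_hom V X) (g : chaus_hom V Y) :
    chaus_hom V (chaus_prod X Y) :=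
  mkcts (fun v => cvg_pair (@cts_fun _ _ f v) (@cts_fun _ _ g v)).

Definition chaus_const (X Y : CHaus) (y : Y) : chaus_hom X Y :=
  mkcts (fun x => @cvg_cst Y y X (nbhs x) _).

Lemma set_type_compact (X : topologicalType) (A : set X) :
  compact A -> compact [set: set_type A].
Proof.
move=> cA G PG _.
have [|p [Ap clp]] := cA (set_val @ G) (fmap_proper_filter _ PG).
  by apply: (@filterS _ G _ setT) => [x _|]; [exact: set_valP|exact: filterT].
exists (exist _ p (mem_set Ap)); split=> // C B GC [_ [[D oD <-]] Dp DB].
have [|_ [[x Cx <-] Dx]] :=
  clp (set_val @` C) D _ (open_nbhs_nbhs (conj oD Dp)).
  by apply: (@filterS _ G _ C _ _ GC) => x Cx; exists x.
by exists x; split=> //; exact: DB.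
Qed.

Lemma set_type_hausdorff (X : topologicalType) (A : set X) :
  hausdorff_space X -> hausdorff_space (set_type A).
Proof.
move=> hX x y cl; apply: val_inj; apply: hX => B C Bx Cy.
have [] := cl (set_val @^-1` B) (set_val @^-1` C).
- exact: (@initial_continuous _ _ set_val).
- exact: (@initial_continuous _ _ set_val).
by move=> t [? ?]; exists (set_val t).
Qed.

Lemma prod_topology_compact (T : Type) (Y : CHaus) :
  compact [set: prod_topology (fun _ : {classic T} => Y)].
Proof.
have := @tychonoff {classic T} (fun=> Y) (fun=> setT)
  (fun=> @chaus_space_compact Y).
by congr compact; apply/seteqP; split.
Qed.

(** [{classic T}] only supplies the decidable equality on the exponent that the
    product topology asks for. *)
Definition chaus_power (T : Type) (Y : CHaus) : CHaus :=
  @MkCHaus (prod_topology (fun _ : {classic T} => Y))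
   (@prod_topology_compact T Y)
   (@hausdorff_product {classic T} (fun=> Y) (fun=> @chaus_space_hausdorff Y)).

Lemma power_proj_cts (T : Type) (Y : CHaus) (t : T) :
  continuous (fun y : chaus_power T Y => y t).
Proof. exact: (@proj_continuous {classic T} (fun=> Y) t). Qed.

Definition chaus_proj (T : Type) (Y : CHaus) (t : T) :
  chaus_hom (chaus_power T Y) Y := mkcts (@power_proj_cts T Y t).

Lemma closed_equalizer (X Y : CHaus) (f g : chaus_hom X Y) :
  closed [set x | f x = g x].
Proof.
move=> x cx; apply: (@chaus_space_hausdorff Y) => A B Ax By.
have [|y [/= fg [fy gy]]] := cx ((f @^-1` A) `&` (g @^-1` B)).
  by apply: filterI; exact: cts_fun.
by exists (f y); split=> //; rewrite fg.
Qed.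

Definition chaus_sub (X : CHaus) (A : set X) (clA : closed A) : CHaus :=
  MkCHaus (set_type_compact (subclosed_compact clA (@chaus_space_compact X)
    (@subsetT _ A)))
   (@set_type_hausdorff X A (@chaus_space_hausdorff X)).

Definition chaus_incl (X : CHaus) (A : set X) (clA : closed A) :
  chaus_hom (chaus_sub clA) X := mkcts (@initial_continuous _ _ set_val).

(** Compatibility of a family of maps out of the one-point space. *)
Definition compatible_points (X : CHaus) (c : cone X)
    (b : forall i, cone_cod c i) : Prop :=
  forall (i j : cone_index c) (Z : CHaus)
    (g : chaus_hom (cone_cod c i) Z) (h : chaus_hom (cone_cod c j) Z),
    chaus_comp g (cone_map c i) = chaus_comp h (cone_map c j) ->
      g (b i) = h (b j).

(** For compact Hausdorff spaces it is enough to test a cone against the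
    one-point space.  A compatible family of maps [V -> Y_i] is compatible at
    each [v], hence lifts to a function [x : V -> X].  It is continuous because
    [X] is compact: a cluster point [p] of [x] at [v] has the same image as
    [x v] in every [Y_i], so [p = x v]. *)
Lemma effective_monic_pointwise (X : CHaus) (c : cone X) :
  separates_points c ->
  (forall b, @compatible_points X c b ->
    exists x, forall i, cone_map c i x = b i) ->
  effective_monic c.
Proof.
move=> sep real V; split.
- move=> m _ i j Z g h gh; apply: chaus_hom_ext => v /=.
  exact: (congr1 (fun k : chaus_hom _ _ => k (m v)) gh).
- move=> m m' _ _ mm'; apply: chaus_hom_ext => v; apply: sep => i.
  exact: (congr1 (fun k => (k i : chaus_hom _ _) v) mm').
- move=> b cb.
  have /choice[x fx] (v : V) : exists x, forall i, cone_map c i x = b i v.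
    apply: real => i j Z g h /cb.
    by move=> /(congr1 (fun k : chaus_hom _ _ => k v)).
  suff cx : continuous (x : V -> X).
    exists (mkcts cx : chaus_hom V X) => //.
    apply: functional_extensionality_dep => i.
    by apply: (@chaus_hom_ext V (cone_cod c i)) => v; exact: fx.
  move=> v.
  have FT : ProperFilter (x @ nbhs v) by exact: fmap_proper_filter.
  apply: (compact_cluster_set1 (@chaus_space_hausdorff X)
    (@chaus_space_compact X) filterT _ filterT) => //.
  have P p : cluster (x @ nbhs v) p -> p = x v.
    move=> clp; apply: sep => i; apply: (@chaus_space_hausdorff (cone_cod c i)).
    move=> A B Ap Bp.
    have bB : nbhs v (b i @^-1` B).
      by apply: (@cts_fun _ _ (b i)); rewrite -fx.
    have [|q [[u Bu <-] Aq]] :=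
        clp (x @` (b i @^-1` B)) _ _ (@cts_fun _ _ (cone_map c i) _ _ Ap).
      by apply: filterS bB => u Bu; exists u.
    by exists (cone_map c i (x u)); split=> //; rewrite fx.
  apply/seteqP; split=> // p /= ->.
  have [q [_ clq]] := @chaus_space_compact X _ FT filterT.
  by rewrite -(P _ clq).
Qed.

End Spaces.

(** * Continuous operations on the unit interval *)

Section Interval.
Local Open Scope classical_set_scope.
Local Open Scope ring_scope.
Variable R : realType.
Notation I := (unit_interval R).
Notation S := (unit_square R).

Definition ival (x : I) : R := set_val x.

Lemma ival_itv (x : I) : 0 <= ival x <= 1.
Proof. by have := set_valP x; rewrite /= in_itv. Qed.

Lemma ival_inj : injective ival.
Proof. exact: val_inj. Qed.

Lemma ival_cts : continuous ival.
Proof. exact: initial_continuous. Qed.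

(** Clamping to [[0, 1]] turns every continuous real function into a map to the
    interval, so that operations can be written down by real formulas. *)
Definition clamp (x : R) : R := Num.max 0 (Num.min 1 x).

Lemma clamp_itv (x : R) : clamp x \in (`[0, 1]%classic : set R).
Proof.
rewrite inE /= in_itv /= /clamp le_max lexx /= ge_max ler01 /=.
by rewrite ge_min lexx.
Qed.

Lemma clamp_id (x : R) : 0 <= x <= 1 -> clamp x = x.
Proof. by move=> /andP[x0 x1]; rewrite /clamp min_r // max_r. Qed.

Lemma clamp_cts : continuous clamp.
Proof.
move=> x; apply: (@continuous_max R R (cst 0) (fun x => Num.min 1 x)).
  exact: cst_continuous.
by apply: (@continuous_min R R (cst 1) id); [exact: cst_continuous|].
Qed.

Definition to_itv (x : R) : I := exist _ (clamp x) (clamp_itv x).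

Lemma to_itv_cts : continuous to_itv.
Proof. exact: (@continuous_comp_initial _ R R ival to_itv clamp_cts). Qed.

Definition itv_map (X : CHaus) (f : X -> R) (cf : continuous f) :
  chaus_hom X I :=
  mkcts (fun x => continuous_comp (cf x) (@to_itv_cts (f x))).

Lemma ival_fst_cts : continuous (fun z : S => ival z.1).
Proof.
by move=> z; apply: continuous_comp; [exact: cvg_fst|exact: ival_cts].
Qed.

Lemma ival_snd_cts : continuous (fun z : S => ival z.2).
Proof.
by move=> z; apply: continuous_comp; [exact: cvg_snd|exact: ival_cts].
Qed.

Lemma max_cts : continuous (fun z : S => Num.max (ival z.1) (ival z.2)).
Proof.
move=> z; apply: (@continuous_max R S (fun z => ival z.1) (fun z => ival z.2)).
  exact: ival_fst_cts.
exact: ival_snd_cts.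
Qed.

Lemma min_cts : continuous (fun z : S => Num.min (ival z.1) (ival z.2)).
Proof.
move=> z; apply: (@continuous_min R S (fun z => ival z.1) (fun z => ival z.2)).
  exact: ival_fst_cts.
exact: ival_snd_cts.
Qed.

Lemma add_cts : continuous (fun z : S => ival z.1 + ival z.2).
Proof.
by move=> z; apply: (@cvgD R R^o); [exact: ival_fst_cts|exact: ival_snd_cts].
Qed.

Lemma sub_cts : continuous (fun z : S => ival z.1 - ival z.2).
Proof.
by move=> z; apply: (@cvgB R R^o); [exact: ival_fst_cts|exact: ival_snd_cts].
Qed.

Lemma dist_cts : continuous (fun z : S => `|ival z.1 - ival z.2|).
Proof. by move=> z; apply: (@cvg_norm R R^o); exact: sub_cts. Qed.

Lemma scale_cts (M : R) : continuous (fun x : I => M * ival x).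
Proof.
move=> x; apply: (@cvgMl_tmp R I (nbhs x) _ (ival : I -> R)).
exact: ival_cts.
Qed.

Definition imax : chaus_hom S I := itv_map max_cts.
Definition imin : chaus_hom S I := itv_map min_cts.
Definition iadd : chaus_hom S I := itv_map add_cts.
Definition isub : chaus_hom S I := itv_map sub_cts.
Definition idist : chaus_hom S I := itv_map dist_cts.
Definition iscale (M : R) : chaus_hom I I := itv_map (@scale_cts M).

Lemma ival_map (X : CHaus) (f : X -> R) (cf : continuous f) x :
  ival (itv_map cf x) = clamp (f x).
Proof. by []. Qed.

End Interval.

Arguments imax {R}.
Arguments imin {R}.
Arguments iadd {R}.
Arguments isub {R}.
Arguments idist {R}.

(** * Recovering points from functions to the interval *)

Section Points.
Local Open Scope classical_set_scope.
Local Open Scope ring_scope.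
Variable R : realType.
Notation I := (unit_interval R).
Notation S := (unit_square R).

Definition izero : I := to_itv 0.
Definition ione : I := to_itv 1.

Lemma izeroE : ival izero = 0.
Proof. by rewrite ?ival_map ?[LHS]clamp_id // lexx ler01. Qed.

Lemma ioneE : ival ione = 1.
Proof. by rewrite ?ival_map ?[LHS]clamp_id // lexx ler01. Qed.

Lemma ival_ge0 (x : I) : 0 <= ival x. Proof. by case/andP: (ival_itv x). Qed.

Lemma ival_le1 (x : I) : ival x <= 1. Proof. by case/andP: (ival_itv x). Qed.

Lemma imaxE (z : S) : ival (imax z) = Num.max (ival z.1) (ival z.2).
Proof.
by rewrite ?ival_map ?[LHS]clamp_id // le_max ge_max !ival_ge0 !ival_le1.
Qed.

Lemma iminE (z : S) : ival (imin z) = Num.min (ival z.1) (ival z.2).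
Proof.
by rewrite ?ival_map ?[LHS]clamp_id // le_min ge_min !ival_ge0 !ival_le1.
Qed.

Lemma iaddE (z : S) : ival (iadd z) = Num.min 1 (ival z.1 + ival z.2).
Proof.
rewrite ival_map /clamp max_r // le_min ler01 /=.
by rewrite addr_ge0 ?ival_ge0.
Qed.

Lemma isubE (z : S) : ival (isub z) = Num.max 0 (ival z.1 - ival z.2).
Proof.
rewrite ival_map /clamp min_r //.
by have := ival_ge0 z.2; have := ival_le1 z.1; lra.
Qed.

Lemma idistE (z : S) : ival (idist z) = `|ival z.1 - ival z.2|.
Proof.
rewrite ?ival_map ?[LHS]clamp_id // normr_ge0 /= ler_norml.
have := ival_ge0 z.2; have := ival_le1 z.1.
by have := ival_ge0 z.1; have := ival_le1 z.2; lra.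
Qed.

Lemma iscaleE (M : R) (x : I) :
  0 <= M -> ival (iscale M x) = Num.min 1 (M * ival x).
Proof.
move=> M0; rewrite ival_map /clamp max_r // le_min ler01 /=.
by rewrite mulr_ge0 ?ival_ge0.
Qed.

Definition lift2 (X : CHaus) (op : chaus_hom S I) (f g : chaus_hom X I) :
  chaus_hom X I := chaus_comp op (chaus_pair f g).

Lemma lift2E (X : CHaus) op (f g : chaus_hom X I) x :
  lift2 op f g x = op (f x, g x).
Proof. by []. Qed.

(** The compactness argument behind all constructions of points.  If [H] has no
    common zero, then near each point some member of [H], suitably scaled, is
    equal to 1; by compactness the maximum of finitely many of them is the
    constant 1.  In place of finite subcovers, the sets that contain
    [{f <> 1}] for some [f] in [H] form a filter, and a cluster point of it is
    a common zero. *)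
Lemma ideal_common_zero (X : CHaus) (H : set (chaus_hom X I)) :
  H (chaus_const X izero) ->
  (forall f g, H f -> H g -> H (lift2 imax f g)) ->
  (forall M f, 1 <= M -> H f -> H (chaus_comp (iscale M) f)) ->
  ~ H (chaus_const X ione) ->
  exists x, forall f, H f -> f x = izero.
Proof.
move=> H0 Hmax Hscale H1.
pose G := [set A | exists2 f, H f & forall y, f y <> ione -> A y].
have FG : ProperFilter G.
  apply: Build_ProperFilter; last first.
    split.
    - by exists (chaus_const X izero).
    - move=> A B [f Hf fA] [g Hg gB].
      exists (lift2 imax f g) => [|y ny]; first exact: Hmax.
      split.
        apply: fA => fy; apply: ny; apply: ival_inj.
        by rewrite imaxE /= fy ioneE max_l // ival_le1.
      apply: gB => gy; apply: ny; apply: ival_inj.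
      by rewrite imaxE /= gy ioneE max_r // ival_le1.
    - by move=> A B AB [f Hf fA]; exists f => // y /fA /AB.
  move=> [f Hf f0]; apply: H1.
  rewrite (_ : chaus_const X ione = f) //; apply: chaus_hom_ext => y /=.
  by apply: contrapT => ny; apply: (f0 y) => fy; apply: ny; rewrite fy.
have [x [_ clx]] := @chaus_space_compact X G FG filterT.
exists x => f Hf; apply: contrapT => fx.
have fx0 : 0 < ival (f x).
  rewrite lt_neqAle ival_ge0 andbT; apply/eqP => fx0; apply: fx.
  by apply: ival_inj; rewrite izeroE.
(* scaling by 2 / f(x) makes f equal to 1 where it exceeds f(x) / 2 *)
pose M := 2 / ival (f x).
have M1 : 1 <= M by rewrite ler_pdivlMr //; have := ival_le1 (f x); lra.
have M0 : 0 <= M by lra.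
have nx : nbhs x [set y | ival (f x) / 2 < ival (f y)].
  have cf : (fun y => ival (f y)) @ x --> ival (f x).
    by apply: continuous_comp; [exact: cts_fun|exact: ival_cts].
  by apply: (cvgr_gt (ival (f x))) => //; lra.
have [|y [/= nfy fy]] := clx [set y | chaus_comp (iscale M) f y <> ione] _ _ nx.
  by exists (chaus_comp (iscale M) f) => //; exact: Hscale.
apply: nfy; apply: ival_inj; rewrite /= iscaleE // ioneE min_l //.
rewrite /M mulrAC ler_pdivlMr //; lra.
Qed.

(** The functions sent to zero have a common zero [x].  Since [Phi] fixes
    constants, [|f - Phi f|] is sent to zero, so it vanishes at [x]. *)
Lemma homomorphism_is_evaluation (X : CHaus) (Phi : chaus_hom X I -> I) :
  (forall op f g, Phi (lift2 op f g) = op (Phi f, Phi g)) ->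
  exists x, forall f, Phi f = f x.
Proof.
move=> homPhi.
have Phi_const c : Phi (chaus_const X c) = c.
  have -> : chaus_const X c =
      lift2 (chaus_const S c) (chaus_const X c) (chaus_const X c).
    exact: chaus_hom_ext.
  by rewrite homPhi.
have Phi_unary k f : Phi (chaus_comp k f) = k (Phi f).
  have -> : chaus_comp k f = lift2 (chaus_comp k chaus_fst) f f.
    exact: chaus_hom_ext.
  by rewrite homPhi.
have [||||x zx] := @ideal_common_zero X [set f | Phi f = izero].
- exact: Phi_const.
- move=> f g /= f0 g0; rewrite homPhi f0 g0; apply: ival_inj.
  by rewrite imaxE /= maxxx.
- move=> M f M1 /= f0; rewrite Phi_unary f0; apply: ival_inj.
  by rewrite iscaleE ?izeroE ?mulr0 ?min_r //; lra.
- move=> /=; rewrite Phi_const => /(congr1 (@ival R)).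
  by rewrite izeroE ioneE => /eqP; rewrite oner_eq0.
exists x => f.
have /(congr1 (@ival R)) : lift2 idist f (chaus_const X (Phi f)) x = izero.
  apply: zx => /=; rewrite homPhi Phi_const; apply: ival_inj.
  by rewrite idistE /= subrr normr0 izeroE.
by rewrite idistE izeroE /= => /normr0_eq0 /subr0_eq/ival_inj.
Qed.

(** Urysohn's lemma. *)
Lemma interval_maps_separate_points (X : CHaus) (x y : X) :
  (forall f : chaus_hom X I, f x = f y) -> x = y.
Proof.
move=> fxy; apply: contrapT => nxy.
have nX : normal_space X.
  apply: compact_normal; first exact: chaus_space_hausdorff.
  exact: chaus_space_compact.
have cl1 (z : X) : closed [set z].
  by apply/accessible_closed_set1/hausdorff_accessible/chaus_space_hausdorff.
have /(normal_uniform_separator nX (cl1 x) (cl1 y)) :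
    [set x] `&` [set y] = set0.
  by apply/seteqP; split=> // z [-> /=] /nxy.
move=> /(@uniform_separatorP X R)[f [cf _ f0 f1]].
have f0x : f x = 0 by apply: f0; exists x.
have f1y : f y = 1 by apply: f1; exists y.
have /(congr1 (@ival R)) := fxy (itv_map cf).
rewrite !ival_map f0x f1y !clamp_id ?lexx ?ler01 // => /eqP.
by rewrite eq_sym oner_eq0.
Qed.

End Points.

Arguments izero {R}.
Arguments ione {R}.

(** * Directed effective-monic cones *)

Section Cones.
Local Open Scope classical_set_scope.
Local Open Scope ring_scope.
Variable R : realType.
Notation I := (unit_interval R).
Notation S := (unit_square R).

Definition chaus_point : CHaus := chaus_power void I.

Definition empty_cone (X : CHaus) : cone X :=
  @Cone X void (fun i => match i with end) (fun i => match i with end).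

Lemma chaus_point_unique (x y : chaus_point) : x = y.
Proof. by apply: functional_extensionality_dep; case. Qed.

(** For a sheaf [F] this says that [F] has exactly one element on the one-point
    space; in particular the constantly empty functor is not a sheaf. *)
Lemma empty_cone_directed : directed_effective_monic (empty_cone chaus_point).
Proof.
split; last by exists (fun i : void => match i with end); split; case.
apply: effective_monic_pointwise => [x y _|b _].
  exact: chaus_point_unique.
by exists (fun t : void => match t with end); case.
Qed.

Definition square_proj (j : bool) : chaus_hom S I :=
  if j then chaus_fst else chaus_snd.

Definition square_cone (X : CHaus) (T : SmallSet) (m : T -> chaus_hom X S) :
  cone X := @Cone X T (fun=> S) m.

(** A family of maps to the square that is closed under pairing coordinates is
    directed, with the two projections of the square as separating maps. *)
Lemma square_cone_directed (X : CHaus) (T : SmallSet) (m : T -> chaus_hom X S) :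
  (forall (t t' : T) (j j' : bool), exists k,
    m k = chaus_pair (chaus_comp (square_proj j) (m t))
                     (chaus_comp (square_proj j') (m t'))) ->
  effective_monic (square_cone m) -> directed_effective_monic (square_cone m).
Proof.
move=> dir em; split=> //.
exists (fun _ => @Cone S bool (fun=> I) square_proj); split.
  move=> t [x1 x2] [y1 y2] xy.
  by congr (_, _); [exact: (xy true)|exact: (xy false)].
move=> t t' j j'; have [k mk] := dir t t' j j'.
exists k, chaus_fst, chaus_snd; rewrite /= mk; split; exact: chaus_hom_ext.
Qed.

Lemma square_ext (p q : S) : p.1 = q.1 -> p.2 = q.2 -> p = q.
Proof. by case: p q => [? ?] [? ?] /= -> ->. Qed.

Definition all_maps_cone (X : CHaus) : cone X :=
  square_cone (fun f : chaus_hom X S => f).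

(** A compatible family of points [b_f], for [f : X -> S], amounts to a
    homomorphism [C(X, I) -> I], sending [g] to a coordinate of [b_(g, g)]. *)
Lemma all_maps_directed (X : CHaus) :
  directed_effective_monic (all_maps_cone X).
Proof.
apply: square_cone_directed => [f f' j j'|]; first by eexists; reflexivity.
apply: effective_monic_pointwise => [x y xy|b cb].
  apply: interval_maps_separate_points => f.
  exact: (congr1 fst (xy (chaus_pair f f))).
pose Phi (f : chaus_hom X I) : I := (b (chaus_pair f f)).1.
have cb' (f g : chaus_hom X S) (u v : chaus_hom S I) :
  chaus_comp u f = chaus_comp v g -> u (b f) = v (b g) by exact: cb.
have [op f g|x Phix] := @homomorphism_is_evaluation R X Phi.
  rewrite [LHS](cb' _ (chaus_pair f g) chaus_fst op); last exact: chaus_hom_ext.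
  congr (op _); apply: square_ext => /=.
    by apply: (cb' _ _ chaus_fst chaus_fst); exact: chaus_hom_ext.
  by apply: (cb' _ _ chaus_snd chaus_fst); exact: chaus_hom_ext.
exists x => f; apply: square_ext.
  transitivity (Phi (chaus_comp chaus_fst f)); first by rewrite Phix.
  by apply: (cb' _ _ chaus_fst chaus_fst); exact: chaus_hom_ext.
transitivity (Phi (chaus_comp chaus_snd f)); first by rewrite Phix.
by apply: (cb' _ _ chaus_fst chaus_snd); exact: chaus_hom_ext.
Qed.

Definition isub_const (e : I) : chaus_hom I I :=
  lift2 isub (chaus_id I) (chaus_const I e).

Lemma isub_constE (e x : I) :
  ival (isub_const e x) = Num.max 0 (ival x - ival e).
Proof. exact: isubE. Qed.

Lemma isub_const_comp (k e x : I) : ival k <= ival e ->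
  isub_const (isub_const k e) (isub_const k x) = isub_const e x.
Proof.
move=> ke; apply: ival_inj; rewrite !isub_constE.
rewrite (max_r (_ : 0 <= ival e - ival k)); last by rewrite subr_ge0.
by case: (leP 0 (ival x - ival k)) => h; case: leP => h1; case: leP => h2; lra.
Qed.

Definition truncation_cone : cone I :=
  @Cone I {e : I | 0 < ival e} (fun=> I) (fun e => isub_const (sval e)).

(** Truncation at [e'] factors through truncation at [e <= e'], so the cone is
    directed.  A compatible family of points [b_e] comes from [0] if all of
    them vanish; otherwise any [d] with [b_d > 0] determines the point
    [b_d + d]. *)
Lemma truncation_cone_directed : directed_effective_monic truncation_cone.
Proof.
split; last first.
  exists (fun _ => @Cone I unit (fun=> I) (fun=> chaus_id I)); split.
    by move=> e x y /(_ tt).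
  move=> e e' [] [].
  wlog ee' : e e' / ival (sval e) <= ival (sval e').
    move=> W; have [/W//|/ltW/W[k [p [q [kp kq]]]]] :=
      leP (ival (sval e)) (ival (sval e')).
    by exists k, q, p.
  exists e, (chaus_id I), (isub_const (isub_const (sval e) (sval e'))).
  split; first exact: chaus_hom_ext.
  by apply: chaus_hom_ext => x; exact: isub_const_comp.
apply: effective_monic_pointwise => [x y xy|b cb].
  wlog xley : x y xy / ival x <= ival y.
    move=> W; have [/W|/ltW/W h] := leP (ival x) (ival y); first exact.
    by symmetry; apply: h.
  apply: ival_inj; apply/eqP; rewrite eq_le xley leNgt; apply/negP => xy'.
  have y0 : 0 < ival y by apply: le_lt_trans xy'; exact: ival_ge0.
  have eE : ival (iscale 2^-1 y) = 2^-1 * ival y.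
    by rewrite iscaleE ?min_r //; have := ival_le1 y; lra.
  have e0 : 0 < ival (iscale 2^-1 y) by rewrite eE; lra.
  have /(congr1 (@ival R)) := xy (exist (fun e : I => 0 < ival e) _ e0).
  rewrite /= !isub_constE /= eE.
  by case: leP => h1; case: leP => h2; lra.
have cb' (d e : {e : I | 0 < ival e}) (u v : chaus_hom I I) :
    (forall x, u (isub_const (sval d) x) = v (isub_const (sval e) x)) ->
    u (b d) = v (b e).
  by move=> uv; apply: cb; exact: chaus_hom_ext.
have [bpos|b0] := pselect (exists d, 0 < ival (b d)); last first.
  exists izero => e; apply: ival_inj.
  have : ~ 0 < ival (b e) by move=> be; apply: b0; exists e.
  move/negP; rewrite -leNgt => be0; have := ival_ge0 (b e).
  rewrite /= isub_constE izeroE => be1.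
  by rewrite max_l; have := ival_ge0 (sval e); lra.
have [d d0] := bpos.
(* Every truncation at e satisfies y = max (min 1 (y + e) - e) 0, and
   compatibility transfers this identity to b_e. *)
have bE e : ival (b e) + ival (sval e) <= 1.
  have -> : b e = isub_const (sval e)
      (lift2 iadd (chaus_id I) (chaus_const I (sval e)) (b e)).
    apply: (cb' e e (chaus_id I) (chaus_comp (isub_const (sval e))
      (lift2 iadd (chaus_id I) (chaus_const I (sval e))))) => x.
    apply: ival_inj; rewrite [RHS]isub_constE iaddE /= isub_constE.
    have := ival_le1 x; have := ival_le1 (sval e); have := ival_ge0 (sval e).
    case: (leP 0 (ival x - ival (sval e))) => h1.
      by rewrite subrK min_r ?ival_le1 // max_r // subr_ge0 -subr_ge0.
    by rewrite add0r min_r ?ival_le1 // subrr maxxx.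
  rewrite isub_constE iaddE /=; have := ival_le1 (sval e).
  by move=> e1; rewrite -lerBrDr ge_max subr_ge0 e1 lerD2r ge_min lexx.
have xE : ival (iadd ((b d : I), (sval d : I))) = ival (b d) + ival (sval d).
  by rewrite iaddE /= min_r ?bE.
exists (iadd ((b d : I), (sval d : I))) => e /=.
have [de|/ltW ed] := leP (ival (sval d)) (ival (sval e)).
  have -> : b e = isub_const (isub_const (sval d) (sval e)) (b d).
    apply: (cb' e d (chaus_id I)) => x.
    by rewrite isub_const_comp.
  apply: ival_inj; rewrite !isub_constE xE.
  by rewrite (max_r (_ : 0 <= _ - ival (sval d))) ?subr_ge0 // opprB addrA.
have : b d = isub_const (isub_const (sval e) (sval d)) (b e).
  by apply: (cb' d e (chaus_id I)) => x; rewrite isub_const_comp.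
move/(congr1 (@ival R)); rewrite !isub_constE.
rewrite (max_r (_ : 0 <= _ - ival (sval e))) ?subr_ge0 // => bdE.
apply: ival_inj; rewrite isub_constE xE; have := ival_ge0 (b e).
move: bdE d0.
case: (leP 0 (ival (b e) - (ival (sval d) - ival (sval e)))) => h1 bdE d0 be0.
  by rewrite (_ : _ + _ - _ = ival (b e)); [rewrite max_r|rewrite bdE; lra].
by move: d0; rewrite bdE ltxx.
Qed.

End Cones.

(** * The algebra F(I) and its characters *)

Section Algebra.
Local Open Scope classical_set_scope.
Local Open Scope ring_scope.
Variable R : realType.
Notation I := (unit_interval R).
Notation S := (unit_square R).
Notation pr1 := (@chaus_fst I I).
Notation pr2 := (@chaus_snd I I).
Variable F : set_functor.
Hypothesis sheafF : is_sheaf F.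

Lemma sheaf_point : exists e : F (chaus_point R), forall e', e' = e.
Proof.
have [_ inj surj] := sheafF (@empty_cone_directed R).
have [|e _ _] := surj (fun i : void => match i with end); first by case.
exists e => e'; apply: inj; rewrite ?in_setT //.
by apply: functional_extensionality_dep; case.
Qed.

(** The element of [F Y] named by a point [y] of [Y]: its image under the map
    from the one-point space, on which [F] has exactly one element. *)
Definition fconst (Y : CHaus) (y : Y) : F Y :=
  fmor F (chaus_const (chaus_point R) y) (projT1 (cid sheaf_point)).

Lemma fmor_const (X Y : CHaus) (w : F X) (y : Y) :
  fmor F (chaus_const X y) w = fconst y.
Proof.
pose bang : chaus_hom X (chaus_point R) :=
  chaus_const X ((fun t : void => match t with end) : chaus_point R).
rewrite (_ : chaus_const X y = chaus_comp (chaus_const (chaus_point R) y) bang);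
  last exact: chaus_hom_ext.
by rewrite fmor_comp /fconst; congr fmor; exact: (projT2 (cid sheaf_point)).
Qed.

Hypothesis prodF : bijective (fun a : F (chaus_prod S S) =>
  (fmor F (@chaus_fst S S) a, fmor F (@chaus_snd S S) a)).

(** The interval is a retract of the square, so bijectivity of
    [F (S * S) -> F S * F S] descends to [F S -> F I * F I]. *)
Lemma fmor_pair_surj (a b : F I) :
  exists s : F S, fmor F pr1 s = a /\ fmor F pr2 s = b.
Proof.
have [mk _ mkK] := prodF.
pose diag := chaus_pair (chaus_id I) (chaus_id I).
have := mkK (fmor F diag a, fmor F diag b).
set w := mk _ => -[wa wb].
exists (fmor F (chaus_pair (chaus_comp pr1 (@chaus_fst S S))
                       (chaus_comp pr1 (@chaus_snd S S))) w).
split; rewrite -fmor_comp.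
  rewrite (_ : chaus_comp _ _ = chaus_comp pr1 (@chaus_fst S S));
    last exact: chaus_hom_ext.
  rewrite fmor_comp wa -fmor_comp -[RHS]fmor_id; congr (fmor F _ _).
  exact: chaus_hom_ext.
rewrite (_ : chaus_comp _ _ = chaus_comp pr1 (@chaus_snd S S));
  last exact: chaus_hom_ext.
rewrite fmor_comp wb -fmor_comp -[RHS]fmor_id; congr (fmor F _ _).
exact: chaus_hom_ext.
Qed.

Lemma fmor_pair_inj (s s' : F S) :
  fmor F pr1 s = fmor F pr1 s' -> fmor F pr2 s = fmor F pr2 s' -> s = s'.
Proof.
move=> s1 s2.
pose diag := chaus_pair (chaus_id I) (chaus_id I).
pose j := chaus_pair (chaus_comp diag pr1) (chaus_comp diag pr2).
pose k := chaus_pair (chaus_comp pr1 (@chaus_fst S S))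
                     (chaus_comp pr1 (@chaus_snd S S)).
have kj : chaus_comp k j = chaus_id S by apply: chaus_hom_ext => -[].
rewrite -[s]fmor_id -[s']fmor_id -kj !fmor_comp; congr fmor.
apply: (bij_inj prodF); rewrite -!fmor_comp.
have j1 : chaus_comp (@chaus_fst S S) j = chaus_comp diag pr1.
  exact: chaus_hom_ext.
have j2 : chaus_comp (@chaus_snd S S) j = chaus_comp diag pr2.
  exact: chaus_hom_ext.
by rewrite j1 j2 !fmor_comp s1 s2.
Qed.

(** Up to four elements of [F I] are images of one element [w].  Identities and
    inequalities between them reduce to pointwise statements about functions
    on the space where [w] lives. *)
Lemma fmor_quad_surj (a b c d : F I) : exists (w : F (chaus_prod S S))
  (qa qb qc qd : chaus_hom (chaus_prod S S) I),
  [/\ a = fmor F qa w, b = fmor F qb w, c = fmor F qc w & d = fmor F qd w].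
Proof.
have [s [<- <-]] := fmor_pair_surj a b; have [t [<- <-]] := fmor_pair_surj c d.
have [mk _ mkK] := prodF; have := mkK (s, t); set w := mk _ => -[ws wt].
exists w, (chaus_comp pr1 (@chaus_fst S S)), (chaus_comp pr2 (@chaus_fst S S)),
  (chaus_comp pr1 (@chaus_snd S S)), (chaus_comp pr2 (@chaus_snd S S)).
by rewrite !fmor_comp ws wt.
Qed.

(** The binary operations on [F I] are well defined: the value depends only on
    the two arguments, not on the element they are images of. *)
Lemma fmor_lift2 (X X' : CHaus) (w : F X) (w' : F X') op f g f' g' :
  fmor F f w = fmor F f' w' -> fmor F g w = fmor F g' w' ->
  fmor F (lift2 op f g) w = fmor F (@lift2 R _ op f' g') w'.
Proof.
move=> ff' gg'; rewrite !fmor_comp; congr fmor.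
have p1 Y (h k : chaus_hom Y I) : chaus_comp pr1 (chaus_pair h k) = h.
  exact: chaus_hom_ext.
have p2 Y (h k : chaus_hom Y I) : chaus_comp pr2 (chaus_pair h k) = k.
  exact: chaus_hom_ext.
by apply: fmor_pair_inj; rewrite -!fmor_comp ?p1 ?p2.
Qed.

Lemma interval_maps_separate_elements (X : CHaus) (w w' : F X) :
  (forall k : chaus_hom X I, fmor F k w = fmor F k w') -> w = w'.
Proof.
move=> ww'; have [_ inj _] := sheafF (@all_maps_directed R X).
apply: inj; rewrite ?in_setT //; apply: functional_extensionality_dep => f.
by apply: fmor_pair_inj; rewrite -!fmor_comp.
Qed.

Notation fzero := (fconst (izero : I)).

(** If [h <= k] then [h = min h k], which at an element where [k] vanishes
    equals [min h 0 = 0]. *)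
Lemma null_le (X : CHaus) (w : F X) (h k : chaus_hom X I) :
  (forall x, ival (h x) <= ival (k x)) ->
  fmor F k w = fzero -> fmor F h w = fzero.
Proof.
move=> hk k0; rewrite (_ : h = lift2 imin h k); last first.
  by apply: chaus_hom_ext => x; apply: ival_inj; rewrite iminE /= min_l.
rewrite (@fmor_lift2 _ X w w imin h k h (chaus_const X izero)) //; last first.
  by rewrite fmor_const.
rewrite -(fmor_const w); congr (fmor F _ _); apply: chaus_hom_ext => x.
by apply: ival_inj; rewrite iminE /= min_r ?izeroE // ival_ge0.
Qed.

Lemma null_max (X : CHaus) (w : F X) (h k : chaus_hom X I) :
  fmor F h w = fzero -> fmor F k w = fzero -> fmor F (lift2 imax h k) w = fzero.
Proof.
move=> h0 k0; rewrite -(fmor_const w) in h0; rewrite -(fmor_const w) in k0.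
rewrite (fmor_lift2 _ h0 k0) -(fmor_const w); congr (fmor F _ _).
by apply: chaus_hom_ext => x; apply: ival_inj; rewrite imaxE maxxx.
Qed.

Lemma fmor_scale0 (M : R) : 0 <= M -> fmor F (iscale M) fzero = fzero.
Proof.
move=> M0; rewrite [in LHS]/fconst -fmor_comp; congr (fmor F _ _).
apply: chaus_hom_ext => x; apply: ival_inj; rewrite /= iscaleE // izeroE mulr0.
by rewrite min_r.
Qed.

Lemma fmor_sub_const0 (e : I) : fmor F (isub_const e) fzero = fzero.
Proof.
rewrite [in LHS]/fconst -fmor_comp; congr (fmor F _ _).
apply: chaus_hom_ext => x; apply: ival_inj; rewrite [LHS]isub_constE /= izeroE.
by rewrite sub0r max_l // oppr_le0 ival_ge0.
Qed.

(** The archimedean property of [F I]: an element all of whose truncations at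
    [e > 0] vanish is zero, because the truncations form a directed
    effective-monic cone. *)
Lemma truncation_neq0 (t : F I) : t <> fzero ->
  exists2 e : I, 0 < ival e & fmor F (isub_const e) t <> fzero.
Proof.
move=> t0; apply: contrapT => H; apply: t0.
have [_ inj _] := sheafF (@truncation_cone_directed R).
apply: inj; rewrite ?in_setT //.
apply: functional_extensionality_dep => -[e e0] /=.
by rewrite fmor_sub_const0; apply: contrapT => te; apply: H; exists e.
Qed.

(** [x = min x y + max (x - y) 0] for the two coordinates of [s]. *)
Lemma sub_eq0 (s : F S) : fmor F isub s = fzero -> fmor F pr1 s = fmor F imin s.
Proof.
move=> s0; rewrite -(fmor_const s) in s0.
have -> : pr1 = lift2 iadd imin isub.
  apply: chaus_hom_ext => z; apply: ival_inj; rewrite iaddE /= iminE isubE.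
  have := ival_le1 z.1; have := ival_le1 z.2.
  case: (leP (ival z.1) (ival z.2)) => h1 z1 z2.
    by rewrite max_l ?subr_le0 // addr0 min_r.
  by rewrite max_r ?subr_ge0 ?(ltW h1) // addrC subrK min_r.
rewrite (@fmor_lift2 _ S s s iadd imin isub imin (chaus_const S izero)) //.
congr (fmor F _ _); apply: chaus_hom_ext => z; apply: ival_inj.
by rewrite iaddE /= izeroE addr0 min_r // ival_le1.
Qed.

(** One of [max (x - y) 0] and [max (y - x) 0] is nonzero at [s]; otherwise both
    coordinates of [s] would equal their minimum. *)
Lemma distinct_difference (s : F S) : fmor F pr1 s <> fmor F pr2 s ->
  exists2 d : chaus_hom S I, fmor F d s <> fzero & forall x, d (x, x) = izero.
Proof.
pose swap := chaus_pair pr2 pr1.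
move=> s12; have [h|h] := pselect (fmor F isub s = fzero); last first.
  exists isub => // x; apply: ival_inj.
  by rewrite isubE /= subrr maxxx izeroE.
exists (chaus_comp isub swap) => [h'|x]; last first.
  by apply: ival_inj; rewrite isubE /= subrr maxxx izeroE.
apply: s12; rewrite (sub_eq0 h).
rewrite fmor_comp in h'; have := sub_eq0 h'.
rewrite -!fmor_comp.
rewrite (_ : chaus_comp _ _ = pr2); last exact: chaus_hom_ext.
move=> ->; congr (fmor F _ _); apply: chaus_hom_ext => z; apply: ival_inj.
by rewrite iminE minC; exact: (esym (iminE (z.2, z.1))).
Qed.

Definition meet (a b : F I) : F I :=
  fmor F imin (projT1 (cid (fmor_pair_surj a b))).

Lemma meetE (X : CHaus) (w : F X) f g :
  meet (fmor F f w) (fmor F g w) = fmor F (lift2 imin f g) w.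
Proof.
rewrite /meet; case: cid => s [/= s1 s2].
rewrite -(fmor_lift2 _ s1 s2); congr (fmor F _ _).
by apply: chaus_hom_ext => -[].
Qed.

Lemma meetA : associative meet.
Proof.
move=> a b c; have [w [qa [qb [qc [_ [-> -> -> _]]]]]] :=
  fmor_quad_surj a b c c.
rewrite !meetE; congr (fmor F _ _); apply: chaus_hom_ext => x; apply: ival_inj.
by rewrite !lift2E !iminE minA.
Qed.

Lemma meetC : commutative meet.
Proof.
move=> a b; have [w [qa [qb [_ [_ [-> -> _ _]]]]]] := fmor_quad_surj a b b b.
rewrite !meetE; congr (fmor F _ _); apply: chaus_hom_ext => x; apply: ival_inj.
by rewrite !iminE minC.
Qed.

Lemma meetxx : idempotent_op meet.
Proof.
move=> a; rewrite -[a]fmor_id meetE; congr (fmor F _ _).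
by apply: chaus_hom_ext => x; apply: ival_inj; rewrite iminE minxx.
Qed.

Lemma meet0 (a : F I) : meet a fzero = fzero.
Proof.
rewrite -[a]fmor_id -(fmor_const a) meetE; congr (fmor F _ _).
apply: chaus_hom_ext => x; apply: ival_inj.
by rewrite iminE /= min_r // izeroE ival_ge0.
Qed.

Lemma meet1 (a : F I) : meet a (fconst (ione : I)) = a.
Proof.
rewrite -[a in LHS]fmor_id -(fmor_const a) meetE -[RHS]fmor_id.
congr (fmor F _ _); apply: chaus_hom_ext => x; apply: ival_inj.
by rewrite iminE /= min_l // ioneE ival_le1.
Qed.

(** Maximality in the form of its consequence [mf_max]: if no meet of [a] with a
    member of [G] is zero, then adjoining all these meets to [G] preserves the
    other two properties, so they belong to [G] already. *)
Record max_filter (G : set (F I)) : Prop := MaxFilter {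
  mf_meet : forall a b, G a -> G b -> G (meet a b);
  mf_zero : ~ G fzero;
  mf_max : forall a, (forall b, G b -> meet b a <> fzero) ->
    forall b, G b -> G (meet b a)
}.

Lemma max_filter_exists (t : F I) : t <> fzero ->
  exists2 G, max_filter G & G t.
Proof.
move=> t0.
(* Empty sets are admitted so that the union of the empty chain qualifies. *)
pose P (G : set (F I)) := (forall a, ~ G a) \/
  [/\ G t, ~ G fzero & forall a b, G a -> G b -> G (meet a b)].
have [|G [PG maxG]] := @Zorn_bigcup _ P.
  move=> C CP totC.
  have [[G0 CG0 [a G0a]]|C0] :=
      pselect (exists2 G, C G & exists a, G a); last first.
    by left=> a [G CG Ga]; apply: C0; exists G => //; exists a.
  right; split.
  - by exists G0 => //; have [/(_ a)//|[]] := CP _ CG0.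
  - by move=> [G CG G0']; have [/(_ _ G0')|[]] := CP _ CG.
  - move=> b c [G CG Gb] [H CH Hc].
    have [GH|HG] := totC _ _ CG CH.
      exists H => //; have [/(_ c)//|[_ _ +]] := CP _ CH.
      by apply=> //; exact: GH.
    exists G => //; have [/(_ b)//|[_ _ +]] := CP _ CG.
    by apply=> //; exact: HG.
have [G0|[Gt Gnz Gmeet]] := PG.
  exfalso; apply: (maxG [set t]).
    by split=> [a /G0//|]; move=> /(_ t erefl)/G0.
  right; split=> //= [/esym//|a b -> ->]; exact: meetxx.
exists G => //; split=> // a aG b Gb; apply: contrapT => nba.
pose G' := G `|` [set meet c a | c in G].
apply: (maxG G').
  split=> [c|G'G]; first by left.
  by apply: nba; apply: G'G; right; exists b.
right; split; first by left.
  by move=> [//|[c Gc /aG]]; exact.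
move=> x y [Gx|[c Gc <-]] [Gy|[d Gd <-]].
- by left; exact: Gmeet.
- by right; exists (meet x d); [exact: Gmeet|rewrite meetA].
- by right; exists (meet c y); [exact: Gmeet|rewrite -!meetA (meetC y)].
- right; exists (meet c d); first exact: Gmeet.
  by rewrite -[RHS]meetA (meetA a) (meetC a) -(meetA d) meetxx meetA.
Qed.

Section Value.
Variables (G : set (F I)) (mG : max_filter G).

(** The filter [G] localizes the element [w] at the point [x]: every function
    that [G] forces to vanish at [w] vanishes at [x]. *)
Definition is_value (X : CHaus) (w : F X) (x : X) : Prop :=
  forall h : chaus_hom X I,
    (exists2 g, G g & meet g (fmor F h w) = fzero) -> h x = izero.

Lemma is_value_fmor (X Y : CHaus) (f : chaus_hom X Y) (w : F X) (x : X) :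
  is_value w x -> is_value (fmor F f w) (f x).
Proof.
by move=> wx h [g Gg g0]; apply: (wx (chaus_comp h f)); exists g;
  rewrite // fmor_comp.
Qed.

(** The functions that [G] forces to vanish at [w] satisfy the hypotheses of
    [ideal_common_zero]; the constant 1 is not among them since [G] omits
    zero. *)
Lemma is_value_exists (t : F I) (X : CHaus) (w : F X) : G t ->
  exists x, is_value w x.
Proof.
move=> Gt.
have [||||x wx] := @ideal_common_zero R X
    [set h | exists2 g, G g & meet g (fmor F h w) = fzero].
- by exists t => //; rewrite fmor_const meet0.
- move=> h k [g Gg gh] [g' Gg' gk]; exists (meet g g').
    exact: mf_meet mG _ _ Gg Gg'.
  have [v [qg [qg' [qh [qk [eg eg' eh ek]]]]]] :=
    fmor_quad_surj g g' (fmor F h w) (fmor F k w).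
  rewrite (fmor_lift2 _ eh ek) eg eg' !meetE.
  move: gh gk; rewrite eg eg' eh ek !meetE => gh gk.
  apply: null_le (null_max gh gk) => x.
  rewrite !lift2E imaxE !iminE /= imaxE /=.
  by case: (leP (ival (qh x)) (ival (qk x))) => _; rewrite le_max; apply/orP;
    [right|left]; rewrite !(le_min, ge_min, lexx, orbT).
- move=> M h M1 [g Gg gh]; exists g => //.
  have [v [qg [qh [_ [_ [eg eh _ _]]]]]] := fmor_quad_surj g (fmor F h w) g g.
  move: gh; rewrite fmor_comp eg eh -fmor_comp !meetE => gh.
  have M0 : 0 <= M by lra.
  apply: (@null_le _ _ _ (chaus_comp (iscale M) (lift2 imin qg qh)));
    last first.
    by rewrite fmor_comp gh fmor_scale0.
  move=> x; rewrite lift2E iminE /= !iscaleE // iminE /=.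
  case: (leP (ival (qg x)) (ival (qh x))) => _; last first.
    by rewrite ge_min lexx orbT.
  by rewrite le_min !ge_min ival_le1 /= ler_peMl ?ival_ge0.
- move=> [g Gg]; rewrite fmor_const meet1 => g0.
  by apply: (mf_zero mG); rewrite -g0.
by exists x.
Qed.

Lemma is_value_nonzero (t : F I) (X : CHaus) (w : F X) (x : X)
    (h : chaus_hom X I) :
  G t -> is_value w x -> h x <> izero -> G (meet t (fmor F h w)).
Proof.
move=> Gt wx hx; apply: (mf_max mG) => // b Gb b0; apply: hx; apply: wx.
by exists b.
Qed.

(** If [min h k] vanished at [w], then so would the meet of two members of
    [G]. *)
Lemma is_value_overlap (t : F I) (X : CHaus) (w : F X) (x y : X)
    (h k : chaus_hom X I) :
  G t -> is_value w x -> is_value w y -> h x <> izero -> k y <> izero ->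
  fmor F (lift2 imin h k) w <> fzero.
Proof.
move=> Gt wx wy hx ky hk0; apply: (mf_zero mG).
have := mf_meet mG (is_value_nonzero Gt wx hx) (is_value_nonzero Gt wy ky).
have [v [qt [qh [qk [_ [et eh ek _]]]]]] :=
  fmor_quad_surj t (fmor F h w) (fmor F k w) t.
move: hk0; rewrite (fmor_lift2 _ eh ek) et eh ek !meetE => hk0.
congr G; apply: null_le hk0 => z.
rewrite !lift2E !iminE.
by rewrite le_min !ge_min !lexx ?orbT.
Qed.

Lemma is_value_unique (t : F I) (a : F I) (x y : I) :
  G t -> is_value a x -> is_value a y -> x = y.
Proof.
move=> Gt ax ay; apply: contrapT => xy.
(* the sets of points closer to x than to y, and vice versa *)
pose dist z := lift2 idist (chaus_id I) (chaus_const I z).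
pose h := lift2 isub (dist y) (dist x); pose k := lift2 isub (dist x) (dist y).
have xy0 : 0 < `|ival x - ival y|.
  by rewrite normr_gt0 subr_eq0; apply/eqP => /ival_inj.
have nz (z : I) : 0 < ival z -> z <> izero.
  by move=> z0 zE; move: z0; rewrite zE izeroE ltxx.
have distE z u : ival (dist z u) = `|ival u - ival z| by exact: idistE.
have hE z : ival (h z) = Num.max 0 (ival (dist y z) - ival (dist x z)).
  exact: isubE.
have kE z : ival (k z) = Num.max 0 (ival (dist x z) - ival (dist y z)).
  exact: isubE.
apply: (@is_value_overlap t I a x y h k Gt ax ay).
- by apply: nz; rewrite hE !distE subrr normr0 subr0 lt_max xy0 orbT.
- by apply: nz; rewrite kE !distE subrr normr0 subr0 distrC lt_max xy0 orbT.
rewrite -(fmor_const a); congr (fmor F _ _); apply: chaus_hom_ext => z.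
apply: ival_inj; rewrite lift2E iminE hE kE izeroE.
case: (leP (ival (dist x z)) (ival (dist y z))) => [xy1|/ltW xy1].
  rewrite (@max_l _ _ 0 (_ - ival (dist y z))) ?subr_le0 // min_r //.
  by rewrite le_max lexx.
by rewrite max_l ?subr_le0 // min_l // le_max lexx.
Qed.

End Value.

Definition is_character (phi : F I -> I) : Prop :=
  forall (op : chaus_hom S I) (s : F S),
    phi (fmor F op s) = op (phi (fmor F pr1 s), phi (fmor F pr2 s)).

(** The value of [a] with respect to a maximal filter is unique and natural in
    [a], hence defines a character.  At the nonzero difference [d] of [a] and
    [b] it cannot be zero, since the filter contains [max (d - e) 0], whose
    meet with [max (e - d) 0] is zero. *)
Lemma characters_separate (a b : F I) :
  (forall phi, is_character phi -> phi a = phi b) -> a = b.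
Proof.
move=> ab; apply: contrapT => nab.
have [s [sa sb]] := fmor_pair_surj a b.
have [|d ds dxx] := @distinct_difference s; first by rewrite sa sb.
have [e e0 te] := truncation_neq0 ds.
have [G mG Gt] := max_filter_exists te.
have ex (a' : F I) : exists x, is_value G a' x.
  exact: (is_value_exists mG a' Gt).
pose phi a' : I := projT1 (cid (ex a')).
have phiP a' : is_value G a' (phi a') by exact: (projT2 (cid (ex a'))).
have phiU a' x : is_value G a' x -> phi a' = x.
  by move=> ax; apply: (is_value_unique mG Gt (phiP a') ax).
have chphi : is_character phi.
  move=> op s'; have [z s'z] := is_value_exists mG s' Gt.
  by rewrite !(phiU _ _ (is_value_fmor s'z)) -surjective_pairing.
have : phi (fmor F d s) = izero by rewrite chphi sa sb ab.
move=> phi0; have := phiP (fmor F d s); rewrite phi0 => v0.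
pose below := lift2 isub (chaus_const I e) (chaus_id I).
have belowE x : ival (below x) = Num.max 0 (ival e - ival x) by exact: isubE.
have below0 : below izero <> izero.
  move/(congr1 (@ival R)); rewrite belowE izeroE subr0 max_r ?ltW // => e0'.
  by move: e0; rewrite e0' ltxx.
apply: (mf_zero mG); have := is_value_nonzero mG Gt v0 below0.
congr G; rewrite meetE -(fmor_const (fmor F d s)); congr (fmor F _ _).
apply: chaus_hom_ext => x; apply: ival_inj.
rewrite lift2E iminE isub_constE belowE izeroE.
case: (leP (ival x) (ival e)) => [xe|/ltW xe].
  by rewrite max_l ?subr_le0 // min_l // le_max lexx.
by rewrite (@max_l _ _ 0 (_ - ival x)) ?subr_le0 // min_r // le_max lexx.
Qed.

End Algebra.

(** * The space of characters represents F *)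

Section Spectrum.
Local Open Scope classical_set_scope.
Local Open Scope ring_scope.
Variable R : realType.
Notation I := (unit_interval R).
Notation S := (unit_square R).
Notation pr1 := (@chaus_fst I I).
Notation pr2 := (@chaus_snd I I).
Variable F : set_functor.
Hypothesis sheafF : is_sheaf F.
Hypothesis prodF : bijective (fun a : F (chaus_prod S S) =>
  (fmor F (@chaus_fst S S) a, fmor F (@chaus_snd S S) a)).

Definition characters : set (chaus_power (F I) I) :=
  [set phi | @is_character R F phi].

Lemma characters_closed : closed characters.
Proof.
rewrite (_ : characters = \bigcap_(o in [set: chaus_hom S I * F S])
  [set phi | chaus_proj I (fmor F o.1 o.2) phi =
    chaus_comp o.1 (chaus_pair (chaus_proj I (fmor F pr1 o.2))
                               (chaus_proj I (fmor F pr2 o.2))) phi]).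
  by apply: closed_bigI => o _; exact: closed_equalizer.
apply/seteqP; split=> [phi chphi [op s] _|phi H op s] /=; first exact: chphi.
exact: (H (op, s) Logic.I).
Qed.

Definition spectrum : CHaus := chaus_sub characters_closed.

Lemma spectrum_character (phi : spectrum) : is_character (set_val phi).
Proof. exact: (set_valP phi). Qed.

Lemma spectrum_ext (phi psi : spectrum) :
  (forall a, set_val phi a = set_val psi a) -> phi = psi.
Proof. by move=> e; apply: val_inj; apply: functional_extensionality_dep. Qed.

Definition eval_at (a : F I) : chaus_hom spectrum I :=
  chaus_comp (chaus_proj I a) (chaus_incl characters_closed).

Definition eval_pair (s : F S) : chaus_hom spectrum S :=
  chaus_pair (eval_at (fmor F pr1 s)) (eval_at (fmor F pr2 s)).

Lemma eval_at_op (op : chaus_hom S I) (s : F S) :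
  eval_at (fmor F op s) = chaus_comp op (eval_pair s).
Proof. by apply: chaus_hom_ext => phi; exact: spectrum_character. Qed.

(** A compatible family of points [b_s], for [s] in [F S], assigns to [a] in
    [F I] a coordinate of [b_(a, a)]; compatibility says that this is a
    character. *)
Lemma spectrum_cone_directed : directed_effective_monic (square_cone eval_pair).
Proof.
apply: square_cone_directed.
  move=> s t j j'.
  have [w [w1 w2]] := fmor_pair_surj prodF
    (fmor F (square_proj R j) s) (fmor F (square_proj R j') t).
  exists w; rewrite /eval_pair w1 w2 !eval_at_op.
  by case: j {w1}; case: j' {w2}; apply: chaus_hom_ext.
apply: effective_monic_pointwise => [phi psi e|b cb].
  apply: spectrum_ext => a; have [s [<- _]] := fmor_pair_surj prodF a a.
  exact: (congr1 fst (e s)).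
have cb' (s t : F S) (u v : chaus_hom S I) :
  chaus_comp u (eval_pair s) = chaus_comp v (eval_pair t) ->
    u (b s) = v (b t) by exact: cb.
have /choice[diag diagP] (a : F I) := fmor_pair_surj prodF a a.
pose x (a : F I) : I := pr1 (b (diag a)).
have xE (op : chaus_hom S I) (s : F S) : x (fmor F op s) = op (b s).
  by apply: cb'; rewrite -!eval_at_op; have [-> _] := diagP (fmor F op s).
have chx : characters x.
  by move=> op s; rewrite !xE -surjective_pairing.
exists (exist _ (x : chaus_power (F I) I) (mem_set chx)) => s.
by apply: square_ext; exact: xE.
Qed.

(** The elements [s] of [F S] themselves form a compatible family: a relation
    between evaluations that holds at all characters holds in [F I], because
    characters separate its elements, and maps to [I] separate the elements of
    the other [F Z]. *)
Lemma universal_element : exists u : F spectrum,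
  forall a, fmor F (eval_at a) u = a.
Proof.
have [_ _ surj] := sheafF spectrum_cone_directed.
have [s t Z g h gh|u _ uE] := surj (fun s : F S => s).
  apply: (interval_maps_separate_elements sheafF prodF) => k.
  rewrite -!fmor_comp; apply: (characters_separate sheafF prodF) => phi chphi.
  pose p : spectrum := exist _ (phi : chaus_power (F I) I)
    (mem_set (chphi : characters phi)).
  change (eval_at (fmor F (chaus_comp k g) s) p =
    eval_at (fmor F (chaus_comp k h) t) p).
  rewrite !eval_at_op; congr (k _).
  exact: (congr1 (fun f : chaus_hom _ _ => f p) gh).
exists u => a; have [s [<- _]] := fmor_pair_surj prodF a a.
by rewrite eval_at_op fmor_comp; congr fmor; exact: (congr1 (fun f => f s) uE).
Qed.

(** For a character [phi], the map [g |-> phi (F g u)] is a homomorphism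
    [C(W, I) -> I], hence the evaluation at some character; taking for [g] the
    evaluations at elements of [F I] shows that this character is [phi].  So
    [F g u] determines [g]. *)
Lemma universal_faithful (u : F spectrum) :
  (forall a, fmor F (eval_at a) u = a) ->
  forall X : CHaus, injective (fun m : chaus_hom spectrum X => fmor F m u).
Proof.
move=> uE.
have evalE (phi : spectrum) (g : chaus_hom spectrum I) :
    set_val phi (fmor F g u) = g phi.
  have [op f h|psi psiE] := @homomorphism_is_evaluation R spectrum
      (fun g => set_val phi (fmor F g u)).
    rewrite fmor_comp spectrum_character -!fmor_comp.
    by congr (op (set_val phi _, set_val phi _)); congr (fmor F _ _);
      exact: chaus_hom_ext.
  rewrite psiE; congr (g _); apply: spectrum_ext => a.
  by rewrite -[in RHS](uE a) psiE.
move=> X m m' mm'; apply: chaus_hom_ext => phi.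
apply: (@interval_maps_separate_points R) => f.
have := evalE phi (chaus_comp f m); rewrite fmor_comp mm' -fmor_comp.
by rewrite (evalE phi (chaus_comp f m')).
Qed.

(** The images [F f x] of [x] in [F S] come from maps [W -> S].  By faithfulness
    these form a compatible family on the cone of all maps [f : X -> S], so
    they come from one map [W -> X]. *)
Lemma universal_full (u : F spectrum) :
  (forall a, fmor F (eval_at a) u = a) ->
  forall (X : CHaus) (x : F X), exists m : chaus_hom spectrum X, fmor F m u = x.
Proof.
move=> uE X x.
have pairE (s : F S) : fmor F (eval_pair s) u = s.
  by apply: (fmor_pair_inj prodF); rewrite -fmor_comp -eval_at_op.
have dirX := @all_maps_directed R X.
have [_ _ surj] := dirX.1 spectrum.
have [f g Z p q pq|m _ mE] :=
  surj (fun f : chaus_hom X S => eval_pair (fmor F f x)).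
  apply: (universal_faithful uE) => /=; rewrite /hom_map !fmor_comp !pairE
    -!fmor_comp.
  exact: (congr1 (fun k => fmor F k x) pq).
exists m; have [_ inj _] := sheafF dirX.
apply: inj; rewrite ?in_setT //; apply: functional_extensionality_dep => f.
rewrite -fmor_comp -[RHS](pairE (fmor F f x)); congr (fmor F _ u).
exact: (congr1 (fun k => k f) mE).
Qed.

Lemma sheaf_representable : representable F.
Proof.
have [u uE] := universal_element; exists spectrum.
pose t X (m : hom_functor spectrum X) : F X := fmor F m u.
have tnat X Y (f : chaus_hom X Y) m :
    t Y (fmor (hom_functor spectrum) f m) = fmor F f (t X m).
  exact: fmor_comp.
pose s X (x : F X) : hom_functor spectrum X :=
  projT1 (cid (universal_full uE x)).
have sK X : cancel (s X) (t X).
  by move=> x; exact: (projT2 (cid (universal_full uE x))).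
have tK X : cancel (t X) (s X).
  by move=> m; apply: (universal_faithful uE); exact: sK.
have snat X Y (f : chaus_hom X Y) a :
    s Y (fmor F f a) = fmor (hom_functor spectrum) f (s X a).
  by apply: (can_inj (tK Y)); rewrite sK tnat sK.
by exists (NatTrans snat), (NatTrans tnat).
Qed.

End Spectrum.

(** * The equivalence *)

Section Equivalence.
Local Open Scope classical_set_scope.

Lemma representable_sheaf_condition (F : set_functor) : representable F ->
  forall (X : CHaus) (c : cone X), effective_monic c -> sheaf_condition F c.
Proof.
move=> [W [s [t [sK tK]]]] X c /(_ W)[_ inj surj]; split.
- move=> a _ i j Z g h gh; rewrite -!fmor_comp.
  exact: (congr1 (fun k => fmor F k a) gh).
- move=> a a' _ _ aa'; apply: (can_inj (sK X)); apply: inj; rewrite ?in_setT //.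
  apply: functional_extensionality_dep => i; rewrite -!naturality.
  by congr (s _ _); exact: (congr1 (fun b => b i) aa').
- move=> b cb; have [i j Z g h gh|m _ mE] := surj (fun i => s _ (b i)).
    by rewrite -!naturality; congr (s _ _); exact: cb.
  exists (t X m) => //; apply: functional_extensionality_dep => i.
  rewrite -naturality -[RHS]sK; congr (t _ _).
  exact: (congr1 (fun b => b i) mE).
Qed.

(** The projections of [S * S] form an effective-monic cone on which every
    family [(a, b)] is compatible: maps [g] and [h] with [g x = h y] for all [x]
    and [y] are constant with the same value, and [F] has only one element over
    a constant map. *)
Lemma product_of_sheaf_condition (R : realType) (F : set_functor) :
  is_sheaf F ->
  (forall (X : CHaus) (c : cone X), effective_monic c -> sheaf_condition F c) ->
  let S := unit_square R in
  bijective (fun a : F (chaus_prod S S) =>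
    (fmor F (@chaus_fst S S) a, fmor F (@chaus_snd S S) a)).
Proof.
move=> sheafF scF S.
pose pr (j : bool) : chaus_hom (chaus_prod S S) S :=
  if j then chaus_fst else chaus_snd.
pose c := @Cone (chaus_prod S S) bool (fun=> S) pr.
have o : S := (izero, izero).
have cst (i : bool) (Z : CHaus) (g h : chaus_hom S Z) :
    chaus_comp g (pr i) = chaus_comp h (pr (~~ i)) ->
    g = chaus_const S (g o) /\ h = chaus_const S (g o).
  move=> gh; have ghE x y : g x = h y.
    case: i gh => gh.
      exact: (congr1 (fun k : chaus_hom (chaus_prod S S) Z => k (x, y)) gh).
    exact: (congr1 (fun k : chaus_hom (chaus_prod S S) Z => k (y, x)) gh).
  by split; apply: chaus_hom_ext => x /=;
    rewrite ?(ghE o o) ?(ghE x o) // -(ghE o x) (ghE o o).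
have pr_inj (i : bool) (Z : CHaus) (g h : chaus_hom S Z) :
    chaus_comp g (pr i) = chaus_comp h (pr i) -> g = h.
  move=> gh; apply: chaus_hom_ext => x.
  have := congr1 (fun k : chaus_hom (chaus_prod S S) Z => k (x, x)) gh.
  by case: i {gh}.
have emc : effective_monic c.
  apply: effective_monic_pointwise => [[x1 x2] [y1 y2] e|b cb].
    by congr (_, _); [exact: (e true)|exact: (e false)].
  by exists (b true, b false) => -[].
have [_ inj surj] := scF _ c emc.
have ex (p : F S * F S) : exists a : F (chaus_prod S S),
    fmor F (@chaus_fst S S) a = p.1 /\ fmor F (@chaus_snd S S) a = p.2.
  have [|a _ aE] := surj (fun j : bool => if j then p.1 else p.2).
    move=> i j Z g h /= gh.
    have [ij|] := eqVneq i j.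
      by move: gh; rewrite ij => /pr_inj ->.
    move=> nij; have ji : j = ~~ i by case: i j nij {g h gh} => -[].
    rewrite ji in h gh *; have [-> ->] := cst _ _ _ _ gh.
    by rewrite !(fmor_const R sheafF).
  exists a; split; first exact: (congr1 (fun f => f true) aE).
  exact: (congr1 (fun f => f false) aE).
have [mk mkP] := choice ex.
exists mk => [a|[p q]]; last by have [/= -> ->] := mkP (p, q).
have [/= e1 e2] := mkP (fmor F (@chaus_fst S S) a, fmor F (@chaus_snd S S) a).
by apply: inj; rewrite ?in_setT //; apply: functional_extensionality_dep => -[].
Qed.

End Equivalence.

Unset Implicit Arguments.

Theorem lemma3p41 (R : realType) (F : set_functor) (hF : is_sheaf F) :
  let S := unit_square R in
  let p1 : chaus_hom (chaus_prod S S) S := chaus_fst in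
  let p2 : chaus_hom (chaus_prod S S) S := chaus_snd in
  [<-> bijective (fun a : F (chaus_prod S S) => (fmor F p1 a, fmor F p2 a));
       (forall (X : CHaus) (c : cone X),
          effective_monic c -> sheaf_condition F c);
       representable F].
Proof.
move=> S p1 p2; tfae.
- move=> prodF; apply: representable_sheaf_condition.
  exact: (sheaf_representable hF prodF).
- move=> scF; apply: (sheaf_representable hF).
  exact: (product_of_sheaf_condition R hF scF).
- move=> repF; apply: (product_of_sheaf_condition R hF).
  exact: representable_sheaf_condition.
Qed.
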